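(* Let $n\geq 3$, let $S=K[x_1,\dots,x_n]$ be a polynomial ring over a field $K$, and let $\mathbf x=\prod_{i=1}^n x_i$. Let $Z_{n-2}=\operatorname{Im}\partial_{n-2}$, where $\partial_\bullet$ is the differential of the Koszul complex on $x_1,\dots,x_n$. Then the ideal $$I=\left(\frac{\mathbf x}{x_ix_j}\ \middle|\ (i,j)\in\{(1,2),(2,3),\dots,(n-1,n),(n,1)\}\right)$$ is a Bourbaki ideal of $Z_{n-2}$.
   Context: The Koszul complex on $x_1,\dots,x_n$ is $0\to K_n\xrightarrow{\partial_n}K_{n-1}\to\cdots\to K_1\xrightarrow{\partial_1}K_0=S$, with $K_j=\bigwedge^j S^n$ and $\partial(\mathbf e_{i_1\dots i_j})=\sum_{k=1}^{j}(-1)^{k+1}x_{i_k}\mathbf e_{i_1\dots\widehat{i_k}\dots i_j}$. An ideal $I$ of $S$ is a Bourbaki ideal of a finitely generated $S$-module $M$ if there is a short exact sequence $0\to F\to M\to I\to 0$ of $S$-modules (a Bourbaki sequence) with $F$ free. *)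

(* Defs.v *)
From HB Require Import structures.
From mathcomp Require Import all_boot all_order all_algebra.
From mathcomp Require Import boolp.
From mathcomp Require Import mpoly.

Set Implicit Arguments.
Unset Strict Implicit.
Unset Printing Implicit Defensive.

Import GRing.Theory.

Local Open Scope ring_scope.

Section Modules.
Variable R : comNzRingType.

(* The module structure on a submodule [U] of [V], with [val] the inclusion. *)
Section Submodule.
Variables (V : lmodType R) (U : submodClosed V).

Definition submod := {x : V | x \in U}.

HB.instance Definition _ := SubChoice.on submod.
HB.instance Definition _ := [SubChoice_isSubLmodule of submod by <:].

End Submodule.

Section Image.
Variables (V W : lmodType R) (f : {linear V -> W}).

Definition im : {pred W} := [pred w | `[< exists v, f v = w >]].

Fact im_submod_closed : submod_closed im.
Proof.
split=> [|a _ _ /asboolP[v <-] /asboolP[w <-]]; apply/asboolP.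
  by exists 0; rewrite linear0.
by exists (a *: v + w); rewrite linearP.
Qed.

HB.instance Definition _ :=
  GRing.isSubmodClosed.Build R W im im_submod_closed.

End Image.

Section Span.
Variables (V : lmodType R) (I : finType) (e : I -> V).

Definition generated : {pred V} :=
  [pred v | `[< exists c : I -> R, v = \sum_i c i *: e i >]].

Fact generated_submod_closed : submod_closed generated.
Proof.
split=> [|a _ _ /asboolP[c ->] /asboolP[d ->]]; apply/asboolP.
  by exists (fun=> 0); rewrite big1 // => i _; rewrite scale0r.
exists (fun i => a * c i + d i); rewrite scaler_sumr -big_split /=.
by apply: eq_bigr => i _; rewrite scalerDl scalerA.
Qed.

HB.instance Definition _ :=
  GRing.isSubmodClosed.Build R V generated generated_submod_closed.

End Span.

Definition finitely_generated (M : lmodType R) : Prop :=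
  exists (m : nat) (e : 'I_m -> M), forall v, v \in generated e.

(* A possibly infinite family: sums run over duplicate-free lists of indices. *)
Definition is_basis (F : lmodType R) (B : eqType) (e : B -> F) : Prop :=
  (forall v, exists (s : seq B) (c : B -> R), v = \sum_(b <- s) c b *: e b) /\
  (forall (s : seq B) (c : B -> R), uniq s ->
     \sum_(b <- s) c b *: e b = 0 -> forall b, b \in s -> c b = 0).

Definition is_free (F : lmodType R) : Prop :=
  exists (B : eqType) (e : B -> F), is_basis e.

Definition short_exact (A B C : lmodType R)
    (f : {linear A -> B}) (g : {linear B -> C}) : Prop :=
  [/\ injective f,
      forall b, g b = 0 <-> exists a, f a = b
    & forall c, exists b, g b = c].

(* Ideals of [R] are the submodules of the regular module [R^o]. *)
Definition bourbaki_ideal (M : lmodType R) (I : submodClosed R^o) : Prop :=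
  finitely_generated M /\
  exists (F : lmodType R) (f : {linear F -> M}) (g : {linear M -> submod I}),
    is_free F /\ short_exact f g.

End Modules.

Section Koszul.
Variables (n : nat) (K : fieldType).
Local Notation S := {mpoly K[n]}.

(* The j-th exterior power of S^n, given by coordinates in the basis of the
   e_(i_1 ... i_j), i_1 < ... < i_j, indexed by the sets {i_1, ..., i_j}. *)
Definition koszul (j : nat) := {ffun {A : {set 'I_n} | #|A| == j} -> S^o}.
HB.instance Definition _ j := GRing.Lmodule.on (koszul j).

(* Junk value 0 when [#|A| != j]. *)
Definition koszul_basis (j : nat) (A : {set 'I_n}) : koszul j :=
  [ffun B => (val B == A)%:R].

(* [enum_val] lists the elements of [A] increasingly, from position 0: the sign
   (-1)^(k+1) for k >= 1 becomes (-1)^k for k >= 0. *)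
Definition koszul_diff_basis (j : nat) (A : {set 'I_n}) : koszul j.-1 :=
  \sum_(k < #|A|)
    ((-1) ^+ k * 'X_(enum_val k) : S) *: koszul_basis j.-1 (A :\ enum_val k).

(* For j = 0 this is the zero map (with a meaningless target). *)
Definition koszul_diff (j : nat) (w : koszul j) : koszul j.-1 :=
  \sum_A (w A : S) *: koszul_diff_basis j (val A).

Fact koszul_diff_is_linear j : linear (@koszul_diff j).
Proof.
move=> a v w; rewrite /koszul_diff scaler_sumr -big_split /=.
by apply: eq_bigr => A _; rewrite !ffunE scalerDl scalerA.
Qed.

HB.instance Definition _ j :=
  GRing.isLinear.Build S (koszul j) (koszul j.-1) _ (@koszul_diff j)
    (@koszul_diff_is_linear j).

Lemma koszul_diffE j (A : {set 'I_n}) :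
  #|A| = j -> koszul_diff (koszul_basis j A) = koszul_diff_basis j A.
Proof.
move=> /eqP cA; rewrite /koszul_diff (bigD1 (exist _ A cA)) //= big1.
  by rewrite ffunE eqxx scale1r addr0.
by move=> B; rewrite -val_eqE ffunE /= => /negPf ->; rewrite scale0r.
Qed.

Definition koszul_image (j : nat) : lmodType S :=
  submod (im (@koszul_diff j)).

(* The quotient of the product of all variables by x_i x_j, for i != j. *)
Definition complementary_monomial (i j : 'I_n) : S :=
  \prod_(k < n | (k != i) && (k != j)) 'X_k.

Lemma complementary_monomialE (i j : 'I_n) : i != j ->
  complementary_monomial i j * ('X_i * 'X_j) = \prod_(k < n) 'X_k.
Proof.
move=> ij; rewrite [RHS](bigD1 i) //= (bigD1 j) /=; last by rewrite eq_sym.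
by rewrite [RHS]mulrA mulrC.
Qed.

(* [ordS] is the cyclic successor i + 1 mod n. *)
Definition cycle_generator (i : 'I_n) : S^o :=
  complementary_monomial i (ordS i).

End Koszul.

(* Main.v *)
From HB Require Import structures.
Require Import Defs.
From mathcomp Require Import all_boot all_order all_algebra.
From mathcomp Require Import boolp mpoly zify ring.

Set Implicit Arguments.
Unset Strict Implicit.
Unset Printing Implicit Defensive.

Import Order.TTheory GRing.Theory.
Local Open Scope ring_scope.

(** Write e_A for the Koszul basis vector of a set A of indices, f_ij for the
    one of the complement of {i, j}, and f_i for the one of the complement of
    {i}.  Up to signs that depend only on the indices, the differential sends
    f_i to the sum of the x_j f_ji.  So, after the signs are absorbed into an
    orientation f_ij = - f_ji, the boundary of a chain with coordinates a_i in
    degree n - 1 has x_i a_j - x_j a_i as its coordinate at f_ij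
    ([edge_coef_diff]).

    Let F be free on the f_ij for which {i, j} is not an edge of the n-cycle,
    mapped to Z_(n-2) by the differential, and let [bourbaki_map] kill these
    f_ij and send f_(i,i+1) to the monomial m_i which is the product of the
    variables other than x_i and x_(i+1).  Its image is the ideal I.

    It vanishes on boundaries, because x_i m_i and x_(i+1) m_i are the products
    of all variables but x_(i+1), resp. x_i, so that the terms cancel around
    the cycle.  Conversely the syzygies of the m_i are exactly the families
    x_i a_(i+1) - x_(i+1) a_i ([gen_syzygy]), so a chain that is sent to 0
    differs from a chain supported off the edges by a boundary.

    Cycles are controlled by the fact that x_i kills the Koszul homology: for a
    cycle w, the chain x_i w is the boundary of the exterior product of e_i and
    w ([diff_wedge]), and S is a domain.  Hence [bourbaki_map] vanishes on
    cycles, which makes it a map on Z_(n-2).  Moreover, if a cycle w is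
    supported off the edges, then x_0 w is the boundary of a chain with a_0 = 0
    and x_i a_(i+1) = x_(i+1) a_i for all i; so all a_i vanish, and w = 0.
    This is the injectivity of F -> Z_(n-2). *)

(** * Free modules of finite functions, and short exact sequences *)

Section Modules.
Variable R : comNzRingType.

Lemma sum_ffun_delta (T : finType) (f : T -> R) (x : T) :
  (\sum_y (f y : R) *: ([ffun z => (z == y)%:R] : {ffun T -> R^o})) x = f x.
Proof.
rewrite sum_ffunE (bigD1 x) //= !ffunE eqxx big1 => [|y /negPf yx].
  by rewrite addr0; exact: mulr1.
by rewrite !ffunE eq_sym yx; exact: mulr0.
Qed.

Lemma ffun_free (T : finType) : is_free {ffun T -> R^o}.
Proof.
exists T, (fun y => [ffun z => (z == y)%:R]).
split=> [v | s c s_uniq sum0 b bs].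
  exists (index_enum T), v.
  by apply/ffunP => x; rewrite sum_ffun_delta.
have := congr1 (fun v : {ffun T -> R^o} => v b) sum0.
rewrite sum_ffunE (bigD1_seq b) //= !ffunE eqxx big1 => [|y /negPf yb].
  by rewrite addr0 => <-; apply/esym; exact: mulr1.
by rewrite !ffunE eq_sym yb; exact: mulr0.
Qed.

Lemma fingen_of_surjective (T : finType) (M : lmodType R)
    (f : {linear {ffun T -> R^o} -> M}) :
  (forall z, exists v, f v = z) -> finitely_generated M.
Proof.
move=> f_onto.
exists #|T|, (fun k => f [ffun z => (z == enum_val k)%:R]) => z.
have [v <-] := f_onto z; apply/asboolP; exists (fun k => v (enum_val k)).
rewrite -(big_enum_val (fun x => (v x : R) *: f [ffun z => (z == x)%:R])) /=.
under eq_bigr do rewrite -linearZ.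
by rewrite -linear_sum; congr (f _); apply/ffunP => x; rewrite sum_ffun_delta.
Qed.

(** Here [d] presents [M] as a quotient of [N], and the sequence
    0 -> F -> M -> I -> 0 is obtained from maps [iota] and [phi] that live on
    [N]; every hypothesis is then a statement on elements of [N].  When [N] is a
    module of Koszul chains, no computation has to take place in the
    submodule of boundaries. *)
Lemma short_exact_of_cover (N M F : lmodType R) (I : submodClosed R^o)
    (d : {linear N -> M}) (phi : {linear N -> R^o}) (iota : {linear F -> N}) :
    (forall z, exists w, d w = z) ->
    (forall w, phi w \in I) -> (forall r, r \in I -> exists w, phi w = r) ->
    (forall w, d w = 0 -> phi w = 0) ->
    (forall v, d (iota v) = 0 -> v = 0) ->
    (forall v, phi (iota v) = 0) ->
    (forall w, phi w = 0 -> exists v, d (iota v) = d w) ->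
  exists (f : {linear F -> M}) (g : {linear M -> submod I}), short_exact f g.
Proof.
move=> d_onto phiI phi_onto d_phi iota_inj phi_iota phi_ker.
have /choice[sec secK] : forall z, exists w, d w = z by [].
pose phiS w : submod I := Sub (phi w) (phiI w).
have phiS_eq w w' : d w = d w' -> phiS w = phiS w'.
  move=> dww'; apply: val_inj; rewrite !SubK; apply/subr0_eq.
  by rewrite -linearB d_phi // linearB dww' subrr.
pose g z := phiS (sec z).
have gd w : g (d w) = phiS w by apply: phiS_eq; rewrite secK.
have g_linear : linear g.
  move=> a z z'; rewrite -{1}(secK z) -{1}(secK z') -linearP gd.
  by apply: val_inj; rewrite linearP !SubK linearP.
pose gL : {linear M -> submod I} :=
  HB.pack g (GRing.isLinear.Build R M (submod I) _ g g_linear).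
have gLd w : gL (d w) = phiS w := gd w.
exists (d \o iota), gL; split.
- move=> v v' /= dvv'; apply/subr0_eq/iota_inj.
  by rewrite !linearB /= dvv' subrr.
- move=> z; split=> [gz0 | [v <-]].
    have [|v dv] := phi_ker (sec z).
      by have := congr1 val gz0; rewrite SubK linear0.
    by exists v; rewrite /= dv secK.
  by apply: val_inj; rewrite gLd SubK linear0 phi_iota.
- move=> r; have [w phiw] := phi_onto _ (valP r).
  by exists (d w); apply: val_inj; rewrite gLd SubK.
Qed.

(** Extension by zero identifies the functions on a subtype with the functions
    on [T] that vanish off [P]. *)
Section Extension.
Variables (T : finType) (P : pred T).

Definition extend (v : {ffun {x | P x} -> R^o}) : {ffun T -> R^o} :=
  [ffun x => oapp v 0 (insub x)].

Fact extend_linear : linear extend.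
Proof.
move=> a v w; apply/ffunP => x; rewrite !ffunE.
by case: insubP => [y _ _|_] /=; rewrite ?ffunE // scaler0 addr0.
Qed.

HB.instance Definition _ :=
  GRing.isLinear.Build R _ _ _ extend extend_linear.

Lemma extend_val v x : extend v (val x) = v x.
Proof. by rewrite ffunE valK. Qed.

Lemma extend_out v x : ~~ P x -> (extend v x : R) = 0.
Proof. by move=> Px; rewrite ffunE insubN. Qed.

Lemma extend_inj : injective extend.
Proof.
by move=> v w /ffunP vw; apply/ffunP => x; rewrite -!extend_val vw.
Qed.

Lemma extend_onto (w : {ffun T -> R^o}) :
  (forall x, ~~ P x -> w x = 0) -> exists v, extend v = w.
Proof.
move=> w0; exists [ffun x => w (val x)]; apply/ffunP => x.
rewrite ffunE; case: insubP => [y _ <-|/w0 ->] //=; by rewrite ffunE.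
Qed.

End Extension.
End Modules.

(** * The Koszul differential on chains of all degrees *)

(** Chains of all degrees are put into the single module of functions on
    subsets.  This avoids a type that changes with the degree; a chain of degree
    [d] becomes its extension by zero from the sets of cardinality [d]. *)
Section Koszul.
Variables (n : nat) (K : fieldType).
Local Notation S := {mpoly K[n]}.
Local Notation W := {ffun {set 'I_n} -> S^o}.
Implicit Types (A B : {set 'I_n}) (i j : 'I_n) (d : nat) (w u : W).

(** For [i] in [A], the exponent is the position of [i] in the increasing
    enumeration of [A]; for [i] outside [A], it is the position that [i] takes
    once it is added. *)
Definition sign A i : S := (-1) ^+ #|[set l in A | (l < i)%N]|.

Lemma signK A i : sign A i * sign A i = 1.
Proof. by rewrite /sign -expr2 sqrr_sign. Qed.

Lemma signU1 A i l :
  l \notin A -> sign (l |: A) i = (if (l < i)%N then -1 else 1) * sign A i.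
Proof.
move=> lA; rewrite /sign.
have -> : [set a in l |: A | (a < i)%N] =
    if (l < i)%N then l |: [set a in A | (a < i)%N]
    else [set a in A | (a < i)%N].
  apply/setP => a; case: ifP => li; rewrite !inE.
    by case: eqP => // ->; rewrite li.
  by case: eqP => //= ->; rewrite li andbF.
by case: ifP => li; rewrite ?mul1r // cardsU1 inE (negPf lA) exprS.
Qed.

Lemma signD1 A i : sign (A :\ i) i = sign A i.
Proof.
rewrite /sign; congr (_ ^+ _); apply: eq_card => a; rewrite !inE.
by case: eqP => // ->; rewrite ltnn !andbF.
Qed.

(** The transpose of the formula for the boundary of a basis vector: the
    coordinate at [B] collects the sets which give [B] when one element is
    deleted. *)
Definition diff w : W :=
  [ffun B : {set 'I_n} =>
     \sum_(i | i \notin B) sign B i * 'X_i * (w (i |: B) : S) : S].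

Fact diff_linear : linear diff.
Proof.
move=> a v w; apply/ffunP => B; rewrite !ffunE scaler_sumr -big_split /=.
apply: eq_bigr => i _; rewrite !ffunE mulrDr; congr (_ + _).
exact: mulrCA.
Qed.

HB.instance Definition _ := GRing.isLinear.Build S W W _ diff diff_linear.

Lemma card_below_enum_val A (k : 'I_#|A|) :
  #|[set l in A | (l < enum_val k)%N]| = k.
Proof.
have x0 : 'I_n := enum_val k.
have szk : (k < size (enum A))%N by rewrite -cardE.
(* [enum_val] follows [enum A], which is increasing because [enum 'I_n] is
   [iota 0 n]. *)
have sortedA : sorted <%O (enum A).
  apply: (sorted_filter lt_trans); rewrite -enumT.
  have := iota_ltn_sorted 0 n; rewrite -val_enum_ord sorted_map.
  by apply: sub_sorted => a b.
rewrite (enum_val_nth x0) -[RHS](count_lt_nth x0 sortedA szk) cardE.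
rewrite -size_filter; congr size.
rewrite /enum_mem -filter_predI; apply: eq_filter => a.
by rewrite !inE andbC.
Qed.

Lemma koszul_diff_basisE d A (B : {B : {set 'I_n} | #|B| == d.-1}) :
  koszul_diff_basis K d A B =
  \sum_(i in A) sign A i * 'X_i * (val B == A :\ i)%:R.
Proof.
rewrite (big_enum_val (fun i => sign A i * 'X_i * (val B == A :\ i)%:R)) /=.
rewrite /koszul_diff_basis sum_ffunE; apply: eq_bigr => k _.
by rewrite !ffunE /sign card_below_enum_val.
Qed.

Lemma extend_koszul_diff d (w : koszul n K d) :
  (0 < d)%N -> extend (koszul_diff w) = diff (extend w).
Proof.
move=> d_gt0; apply/ffunP => B; rewrite [RHS]ffunE.
have [cB|cB] := boolP (#|B| == d.-1); last first.
  rewrite extend_out // big1 // => i iB; rewrite extend_out ?mulr0 //.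
  by apply: contraNneq cB => <-; rewrite cardsU1 iB.
have <- : val (exist (fun B => #|B| == d.-1) B cB) = B by [].
rewrite extend_val /koszul_diff sum_ffunE.
pose F A : S := extend w A * \sum_(i in A) sign A i * 'X_i * (B == A :\ i)%:R.
transitivity (\sum_A F A).
  rewrite [RHS](bigID (fun A => #|A| == d)) /= [X in _ + X]big1 => [|A cA].
    rewrite addr0 (big_sub (fun A => #|A| == d)) /=; apply: eq_bigr => A _.
    by rewrite ffunE koszul_diff_basisE /F extend_val.
  by rewrite /F extend_out // mul0r.
under eq_bigr do rewrite /F mulr_sumr.
rewrite (exchange_big_dep xpredT) //= [RHS]big_mkcond /=.
apply: eq_bigr => i _; case: ifP => iB; last first.
  rewrite big1 // => A iA; case: eqP => [BE|_]; last by rewrite !mulr0.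
  by rewrite BE !inE eqxx in iB.
rewrite (bigD1 (i |: B)) ?setU11 //= setU1K // eqxx mulr1 big1 ?addr0.
  by rewrite -signD1 setU1K // mulrC.
move=> A /andP[iA AB]; case: eqP => [BE|_]; last by rewrite !mulr0.
by rewrite BE setD1K // eqxx in AB.
Qed.

(** Diagonal terms have to be excluded by hypothesis: in characteristic 2,
    skew symmetry does not make them vanish. *)
Lemma sum_alternating (V : zmodType) (F : 'I_n -> 'I_n -> V) :
    (forall i, F i i = 0) -> (forall i j, F i j = - F j i) ->
  \sum_i \sum_j F i j = 0.
Proof.
move=> F0 FN.
have split i : \sum_j F i j =
    \sum_(j < n | (j < i)%N) F i j + \sum_(j < n | (i < j)%N) F i j.
  rewrite (bigID (fun j : 'I_n => (j < i)%N)) /=; congr (_ + _).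
  rewrite (bigD1 i) ?ltnn //= F0 add0r; apply: eq_bigl => j.
  by rewrite -leqNgt ltn_neqAle eq_sym andbC.
under eq_bigr do rewrite split.
rewrite big_split /= [X in _ + X](exchange_big_dep xpredT) //=.
rewrite -big_split big1 //= => i _; rewrite -big_split big1 // => j _.
by rewrite /= FN addNr.
Qed.

Lemma diffK w : diff (diff w) = 0.
Proof.
apply/ffunP => B; rewrite !ffunE.
(* The coordinate at [B] of the double differential is the sum over the ordered
   pairs (i, j) that can be added to [B]; exchanging [i] and [j] changes the
   sign of one factor. *)
pose F i j : S :=
  if [&& i \notin B, j \notin B & j != i] then
    sign B i * 'X_i * (sign (i |: B) j * 'X_j * w (j |: (i |: B))) else 0.
transitivity (\sum_i \sum_j F i j).
  rewrite big_mkcond /=; apply: eq_bigr => i _; rewrite /F.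
  case: ifP => iB /=; last by rewrite big1.
  rewrite ffunE mulr_sumr [LHS]big_mkcond /=.
  by apply: eq_bigr => j _; rewrite !inE negb_or andbC.
apply: sum_alternating => [i|i j]; rewrite /F ?eqxx ?andbF //.
rewrite eq_sym; case: (i == j) / eqP => [->|/eqP ij].
  by rewrite !andbF oppr0.
case iB: (i \notin B); case jB: (j \notin B); rewrite /= ?oppr0 //.
rewrite setUCA !signU1 //.
case: (ltngtP i j) => [_|_|/val_inj/eqP]; [ring|ring|by rewrite (negPf ij)].
Qed.

(** Left exterior multiplication by the basis vector of index [i]. *)
Definition wedge i w : W :=
  [ffun A : {set 'I_n} =>
     (if i \in A then sign A i * (w (A :\ i) : S) else 0) : S].

(** Exterior multiplication by the i-th basis vector is a homotopy from 0 to
    multiplication by x_i; this is the reason why x_i kills the Koszul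
    homology. *)
Lemma wedge_homotopy i w :
  diff (wedge i w) + wedge i (diff w) = ('X_i : S) *: w.
Proof.
apply/ffunP => B; rewrite !ffunE; have [iB|iB] := boolP (i \in B).
  rewrite [X in _ * X](bigD1 i) ?setD11 //= setD1K // mulrDr addrCA.
  rewrite signD1 !mulrA signK mul1r.
  rewrite [X in _ + X](_ : _ = 0) ?addr0 // mulr_sumr.
  rewrite [X in _ + X](eq_bigl (fun j => j \notin B)); last first.
    move=> j; rewrite !inE; case: eqP => [->|_]; by rewrite ?iB ?andbF ?andbT.
  rewrite -big_split; apply: big1 => j jB /=.
  have ji : j != i by apply: contraNneq jB => ->.
  rewrite ffunE !inE iB orbT signU1 //.
  have -> : (j |: B) :\ i = j |: (B :\ i).
    apply/setP => a; rewrite !inE andb_orr; congr (_ || _).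
    by case: (a =P j) => [->|_]; rewrite ?ji ?andbF.
  rewrite -{1}(setD1K iB) signU1 ?setD11 //.
  case: (ltngtP i j) ji => [_ _|_ _|/val_inj ->]; [ring|ring|by rewrite eqxx].
rewrite addr0 (bigD1 i) //= ffunE setU11 -(signD1 (i |: B)) setU1K //.
rewrite big1 => [|j /andP[jB ji]].
  by rewrite addr0 mulrACA signK mul1r.
by rewrite ffunE !inE (negPf iB) eq_sym (negPf ji) mulr0.
Qed.

Lemma diff_wedge i w : diff w = 0 -> diff (wedge i w) = ('X_i : S) *: w.
Proof.
move=> dw0; rewrite -wedge_homotopy dw0 [X in _ + X](_ : _ = 0) ?addr0 //.
by apply/ffunP => A; rewrite !ffunE mulr0 if_same.
Qed.

(** * Coordinates in degrees n - 2 and n - 1 *)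

(** The sign which makes the coordinate at the complement of {i, j} skew in
    [i] and [j].  Without it, the edge from n - 1 to 0 of the cycle would carry
    another sign than the others. *)
Definition orientation i j : S :=
  (if (j < i)%N then -1 else 1) * (sign setT i * sign setT j).

Definition edge_coef w i j : S := orientation i j * w (~: [set i; j]).

Definition vertex_coef w i : S := sign setT i * w (~: [set i]).

Lemma orientationK i j : orientation i j * orientation i j = 1.
Proof.
rewrite /orientation mulrACA [X in _ * X = _]mulrACA !signK.
by case: ifP; rewrite ?mulrNN !mulr1.
Qed.

(** Only [i] and [j] can be added to the complement of {i, j}. *)
Lemma edge_coef_diff w i j : i != j ->
  edge_coef (diff w) i j = 'X_i * vertex_coef w j - 'X_j * vertex_coef w i.
Proof.
(* The contribution of the set obtained by adding [a], whose complement is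
   [b]. *)
have term a b : a != b ->
    sign (~: [set a; b]) a * 'X_a * (w (a |: ~: [set a; b]) : S) =
    (if (b < a)%N then -1 else 1) * sign setT a * 'X_a * w (~: [set b]).
  move=> ab.
  have -> : a |: ~: [set a; b] = ~: [set b].
    by apply/setP => c; rewrite !inE; case: eqP => [->|_].
  have -> : ~: [set a; b] = ~: [set b] :\ a.
    by apply/setP => c; rewrite !inE negb_or.
  have -> : setT = b |: ~: [set b] by rewrite setUCr.
  rewrite signD1 signU1 ?inE ?eqxx // mulrA.
  by case: ifP; rewrite ?mulrNN !mul1r.
move=> ij; rewrite /edge_coef ffunE (bigD1 i) ?inE ?eqxx //=.
rewrite (bigD1 j) /= ?inE ?eqxx ?orbT 1?eq_sym //= big1 => [|k]; last first.
  by rewrite !inE negbK => /andP[/andP[/orP[/eqP->|/eqP->]]]; rewrite ?eqxx.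
rewrite addr0 term // (setUC [set i]) term 1?eq_sym //.
rewrite /orientation /vertex_coef.
have := signK setT i; have := signK setT j.
move: (sign setT i) (sign setT j) => si sj sjK siK.
transitivity ('X_i * (sj * (w (~: [set j]) : S)) * (si * si) -
              'X_j * (si * (w (~: [set i]) : S)) * (sj * sj)); last first.
  by rewrite siK sjK !mulr1.
by case: (ltngtP i j) ij => [_ _|_ _|/val_inj ->]; [ring|ring|rewrite eqxx].
Qed.

(** * Syzygies of the cycle monomials *)

(** The substitution of 0 for x_i; by [kill_mod], it computes residues modulo
    x_i. *)
Definition kill i (p : S) : S :=
  p \mPo [tuple (if l == i then 0 else 'X_l : S) | l < n].

HB.instance Definition _ i := GRing.RMorphism.copy (kill i)
  (comp_mpoly [tuple (if l == i then 0 else 'X_l : S) | l < n]).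

Lemma kill_X i j : kill i 'X_j = if j == i then 0 else 'X_j.
Proof. by rewrite /kill comp_mpolyXU -tnth_nth tnth_mktuple. Qed.

Lemma kill_mod i p : exists q, p = kill i p + 'X_i * q.
Proof.
pose P p := exists q, p = kill i p + 'X_i * q.
(* Every polynomial is a linear combination of products of variables, and the
   property is stable under products. *)
have PM p1 p2 : P p1 -> P p2 -> P (p1 * p2).
  move=> [q1 e1] [q2 e2]; exists (q1 * p2 + kill i p1 * q2).
  by rewrite rmorphM {1}e1 mulrDl -mulrA {1}e2 mulrDr mulrDr; ring.
have PX j : P 'X_j.
  rewrite /P kill_X; case: eqP => [->|_].
    by exists 1; rewrite mulr1 add0r.
  by exists 0; rewrite mulr0 addr0.
have P1 : P 1 by exists 0; rewrite rmorph1 mulr0 addr0.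
have Pmon m : P 'X_[m].
  rewrite mpolyXE_id; apply: (big_ind P) => // j _.
  by elim: (m j) => [|e IHe]; rewrite ?expr0 // exprS; apply: PM.
elim/mpolyind: p => [|a m p _ _ [q e]].
  by exists 0; rewrite rmorph0 mulr0 addr0.
have [qm em] := Pmon m; exists (a *: qm + q).
rewrite {1}e {1}em rmorphD /= {3}/kill comp_mpolyZ -/(kill i _).
by rewrite scalerDr mulrDr scalerAr addrACA.
Qed.

Lemma mpolyX_neq0 i : 'X_i != 0 :> S.
Proof.
apply/eqP => /(congr1 (meval (fun=> 1 : K))) /eqP.
by rewrite mevalXU rmorph0 oner_eq0.
Qed.

Lemma prod_mpolyX_neq0 (P : pred 'I_n) : \prod_(i < n | P i) 'X_i != 0 :> S.
Proof. by apply/prodf_neq0 => i _; apply: mpolyX_neq0. Qed.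

Lemma val_ordS i : ordS i = (if i.+1 == n then 0 else i.+1)%N :> nat.
Proof.
rewrite /=; case: eqP => [->|/eqP ni]; first by rewrite modnn.
by rewrite modn_small // ltn_neqAle ni ltn_ord.
Qed.

(** The partial sums are well defined on the cycle because the total sum
    vanishes. *)
Lemma cycle_telescope (V : zmodType) (e : 'I_n -> V) :
  \sum_i e i = 0 -> exists t, forall i, e i = t (ordS i) - t i.
Proof.
move=> sum0; exists (fun i => \sum_(l < n | (l < i)%N) e l) => i.
have step : \sum_(l < n | (l < i.+1)%N) e l =
    e i + \sum_(l < n | (l < i)%N) e l.
  rewrite (bigD1 i) //=; congr (_ + _); apply: eq_bigl => l.
  by rewrite ltnS [RHS]ltn_neqAle andbC.
have -> : \sum_(l < n | (l < ordS i)%N) e l = \sum_(l < n | (l < i.+1)%N) e l.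
  rewrite val_ordS; case: eqP => // ->; rewrite big_pred0 // -[LHS]sum0.
  by apply: eq_bigl => l; rewrite ltn_ord.
by rewrite step addrK.
Qed.

Lemma ordS_ind (i0 : 'I_n) (P : 'I_n -> Prop) : i0 = 0%N :> nat ->
  P i0 -> (forall i, P i -> P (ordS i)) -> forall i, P i.
Proof.
move=> i0E P0 PS [i i_lt]; elim: i => [|i IHi] in i_lt *.
  by congr P: P0; apply: val_inj.
have := PS _ (IHi (ltnW i_lt)); congr P; apply: val_inj.
by apply: etrans (val_ordS _) _; rewrite /= ltn_eqF.
Qed.

Section Cycle.
Hypothesis n_ge3 : (3 <= n)%N.
Local Notation gen i := (cycle_generator K i : S).

Lemma ordS_neq i : ordS i != i.
Proof.
apply/eqP => /(congr1 (@nat_of_ord n)); rewrite val_ordS.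
by have := ltn_ord i; case: eqP; lia.
Qed.

Lemma ordSS_neq i : ordS (ordS i) != i.
Proof.
apply/eqP => /(congr1 (@nat_of_ord n)); rewrite !val_ordS.
have := ltn_ord i; by case: (i.+1 =P n); case: eqP; lia.
Qed.

Lemma edge_inj : injective (fun i => [set i; ordS i]).
Proof.
move=> i j /= eq_ij.
have : i \in [set j; ordS j] by rewrite -eq_ij set21.
have : ordS i \in [set j; ordS j] by rewrite -eq_ij set22.
rewrite !inE => Sij /orP[/eqP // | /eqP iS]; move: Sij.
by rewrite iS (negPf (ordSS_neq j)) (negPf (ordS_neq _)).
Qed.

Definition prod_except i : S := \prod_(l < n | l != i) 'X_l.

Lemma mulX_gen i : 'X_i * gen i = prod_except (ordS i).
Proof.
rewrite /prod_except (bigD1 i) /=; last by rewrite eq_sym ordS_neq.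
by congr (_ * _); apply: eq_bigl => l; rewrite andbC.
Qed.

Lemma mulXS_gen i : 'X_(ordS i) * gen i = prod_except i.
Proof. by rewrite /prod_except (bigD1 (ordS i)) ?ordS_neq. Qed.

Lemma gen_relation (a : 'I_n -> S) :
  \sum_i ('X_i * a (ordS i) - 'X_(ordS i) * a i) * gen i = 0.
Proof.
under eq_bigr do
  rewrite mulrBl mulrAC mulX_gen [X in _ - X]mulrAC mulXS_gen.
by rewrite sumrB [X in _ - X](reindex_inj (@ordS_inj n)) subrr.
Qed.

(** Of all the generators, only those of the two edges through [ordS i] are not
    divisible by the variable of index [ordS i]. *)
Lemma gen_congruence (c : 'I_n -> S) i : \sum_l c l * gen l = 0 ->
  kill (ordS i) (c i) * 'X_(ordS (ordS i)) +
  kill (ordS i) (c (ordS i)) * 'X_i = 0.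
Proof.
set j := ordS i; set k := ordS j => /(congr1 (kill j)).
have [ji kj ki] : [/\ j != i, k != j & k != i].
  by rewrite !ordS_neq ordSS_neq.
(* The common factor that is cancelled from the two surviving terms. *)
pose r : S := \prod_(l < n | [&& l != i, l != j & l != k]) 'X_l.
have kill_gen l : l \in [:: i; j] -> kill j (gen l) = gen l.
  move=> lij; rewrite rmorph_prod; apply: eq_bigr => a /andP[al aSl].
  rewrite /= kill_X; case: eqP => // aj; move: lij al aSl; rewrite aj !inE.
  by case/orP=> /eqP ->; rewrite ?eqxx.
have gen_i : gen i = 'X_k * r.
  rewrite /cycle_generator /complementary_monomial (bigD1 k) ?ki ?kj //=.
  by congr (_ * _); apply: eq_bigl => l; rewrite andbA.
have gen_j : gen j = 'X_i * r.
  rewrite /cycle_generator /complementary_monomial (bigD1 i) /=; last first.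
    by rewrite eq_sym ji eq_sym ki.
  by congr (_ * _); apply: eq_bigl => l; rewrite andbC andbA.
rewrite rmorph0 rmorph_sum (bigD1 i) //= (bigD1 j) //=.
rewrite big1 => [|l /andP[li lj]].
  rewrite !rmorphM /= !kill_gen ?inE ?eqxx ?orbT // gen_i gen_j addr0 !mulrA.
  move/eqP; rewrite -mulrDl mulf_eq0 (negPf (prod_mpolyX_neq0 _)) orbF.
  by move/eqP.
rewrite rmorphM /= [X in _ * X]rmorph_prod (bigD1 j) /=; last first.
  by rewrite eq_sym lj (inj_eq (@ordS_inj n)) eq_sym.
by rewrite kill_X eqxx mul0r mulr0.
Qed.

(** By [gen_congruence], each [c i] lies in the ideal of x_i and x_(i+1), say
    c_i = x_(i+1) a_i + x_i b_i, and x_(i+1) divides b_i + a_(i+1), with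
    quotient e_i.  Then c_i = x_(i+1) a_i - x_i a_(i+1) + x_i x_(i+1) e_i, and
    since the first two terms form a syzygy, the e_i sum to 0.  Writing
    e_i = t_(i+1) - t_i, the last term is absorbed by replacing a_i by
    a_i - x_i t_i. *)
Lemma gen_syzygy (c : 'I_n -> S) : \sum_i c i * gen i = 0 ->
  exists a, forall i, c i = 'X_i * a (ordS i) - 'X_(ordS i) * a i.
Proof.
move=> sum0; have congr_c := gen_congruence _ sum0.
have /fin_all_exists[ab cE] : forall i, exists ab : S * S,
    c i = 'X_(ordS i) * ab.1 + 'X_i * ab.2.
  move=> i; have [a ->] := kill_mod (ordS i) (c i).
  have [b ->] := kill_mod i (kill (ordS i) (c i)).
  have /eqP := congr1 (kill i) (congr_c i).
  rewrite rmorphD !rmorphM rmorph0 /= !kill_X eqxx (negPf (ordSS_neq i)).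
  rewrite mulr0 addr0 mulf_eq0 (negPf (mpolyX_neq0 _)) orbF => /eqP ->.
  by exists (a, b); rewrite add0r addrC.
pose a i := (ab i).1; pose b i := (ab i).2.
have /fin_all_exists[e eE] : forall i, exists e : S,
    b i = 'X_(ordS i) * e - a (ordS i).
  move=> i; have [e eE] := kill_mod (ordS i) (b i + a (ordS i)).
  exists e; apply/eqP; rewrite eq_sym subr_eq eq_sym eE; apply/eqP.
  suff -> : kill (ordS i) (b i + a (ordS i)) = 0 by rewrite add0r.
  have := congr_c i; rewrite !cE -/(a _) -/(b _) -/(a _) -/(b _).
  rewrite !(rmorphD, rmorphM) /= !kill_X eqxx (negPf (ordS_neq _)).
  rewrite eq_sym (negPf (ordS_neq _)) !mul0r add0r addr0 -/(a _).
  rewrite mulrAC [X in _ + X]mulrAC [X in _ + X * _]mulrC -mulrDr.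
  by move/eqP; rewrite !mulf_eq0 !(negPf (mpolyX_neq0 _)) => /eqP.
have cE' i : c i =
    'X_(ordS i) * a i - 'X_i * a (ordS i) + 'X_i * 'X_(ordS i) * e i.
  by rewrite cE -/(a i) -/(b i) eE; ring.
have [|t tE] := @cycle_telescope _ e.
  pose P : S := \prod_(l < n) 'X_l.
  have : P * \sum_i e i = 0.
    rewrite -[RHS]addr0 -[X in X + _]sum0 -[X in _ + X](gen_relation a).
    rewrite mulr_sumr -big_split; apply: eq_bigr => i _ /=.
    have <- : gen i * ('X_i * 'X_(ordS i)) = P.
      by rewrite complementary_monomialE // eq_sym ordS_neq.
    by rewrite cE'; ring.
  by move/eqP; rewrite mulf_eq0 (negPf (prod_mpolyX_neq0 _)) => /eqP.
exists (fun i => 'X_i * t i - a i) => i.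
by rewrite cE' tE; ring.
Qed.

(** * The map onto the ideal *)

Definition bourbaki_map w : S^o := \sum_i edge_coef w i (ordS i) * gen i.

Fact bourbaki_map_linear : linear bourbaki_map.
Proof.
move=> a v w; rewrite /bourbaki_map scaler_sumr -big_split /=.
apply: eq_bigr => i _; rewrite /edge_coef !ffunE mulrDr mulrDl.
congr (_ + _).
exact: etrans (congr1 ( *%R^~ _) (mulrCA _ _ _)) (esym (mulrA _ _ _)).
Qed.

HB.instance Definition _ :=
  GRing.isLinear.Build S W S^o _ bourbaki_map bourbaki_map_linear.

Lemma bourbaki_map_diff w : bourbaki_map (diff w) = 0.
Proof.
rewrite -[RHS](gen_relation (vertex_coef w)).
by apply: eq_bigr => i _; rewrite edge_coef_diff // eq_sym ordS_neq.
Qed.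

(** A multiple of a cycle by a variable is a boundary, and the target has no
    torsion. *)
Lemma bourbaki_map_cycle w : diff w = 0 -> bourbaki_map w = 0.
Proof.
move=> dw0; pose i : 'I_n := Ordinal (ltnW (ltnW n_ge3)).
have /eqP : 'X_i * (bourbaki_map w : S) = 0.
  by have := bourbaki_map_diff (wedge i w); rewrite diff_wedge // linearZ.
by rewrite mulf_eq0 (negPf (mpolyX_neq0 _)) => /eqP.
Qed.

(** The syzygy that [w] gives provides the coordinates of [u]; by
    [edge_coef_diff], its boundary has the same coordinates on the edges as
    [w]. *)
Lemma bourbaki_map_ker w : bourbaki_map w = 0 -> exists2 u : W,
  forall A, #|A| != n.-1 -> u A = 0 &
  forall i, (w - diff u) (~: [set i; ordS i]) = 0.
Proof.
move=> /gen_syzygy[a aE].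
pose u : W := [ffun A : {set 'I_n} =>
  \sum_(i | A == ~: [set i]) sign setT i * a i : S].
exists u => [|i].
  move=> A cA; rewrite ffunE big_pred0 // => i; apply: contraNF cA => /eqP ->.
  by rewrite cardsC1 card_ord.
have vertex_u l : vertex_coef u l = a l.
  rewrite /vertex_coef ffunE (big_pred1 l) ?mulrA ?signK ?mul1r // => m.
  by rewrite (inj_eq (@setC_inj _)) (inj_eq (@set1_inj _)) eq_sym.
have : edge_coef (w - diff u) i (ordS i) = 0.
  have -> : edge_coef (w - diff u) i (ordS i) =
      edge_coef w i (ordS i) - edge_coef (diff u) i (ordS i).
    by rewrite -mulrBr; congr (_ * _); rewrite !ffunE.
  rewrite edge_coef_diff 1?eq_sym ?ordS_neq // !vertex_u.
  by rewrite aE subrr.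
move/(congr1 ( *%R (orientation i (ordS i)))).
by rewrite /edge_coef mulrA orientationK mul1r mulr0.
Qed.

(** The chain [wedge i0 w] has no coordinate at the complement of [i0], and its
    boundary x_0 w vanishes on the edges; the relations
    x_i a_(i+1) = x_(i+1) a_i propagate the vanishing around the cycle. *)
Lemma no_cycle_off_edges w :
    (forall A, #|A| != (n - 2)%N -> w A = 0) ->
    (forall i, w (~: [set i; ordS i]) = 0) ->
  diff w = 0 -> w = 0.
Proof.
move=> w_deg w_edge dw0; pose i0 : 'I_n := Ordinal (ltnW (ltnW n_ge3)).
have coefE i j : i != j -> 'X_i * vertex_coef (wedge i0 w) j
    - 'X_j * vertex_coef (wedge i0 w) i = 'X_i0 * edge_coef w i j.
  move=> ij; rewrite -edge_coef_diff // diff_wedge // /edge_coef ffunE.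
  exact: mulrCA.
have vertex0 i : vertex_coef (wedge i0 w) i = 0.
  elim/(@ordS_ind i0): i => // [|i IHi].
    by rewrite /vertex_coef ffunE !inE eqxx mulr0.
  have := coefE i (ordS i); rewrite eq_sym ordS_neq IHi mulr0 subr0.
  rewrite /edge_coef w_edge !mulr0 => /(_ isT) /eqP.
  by rewrite mulf_eq0 (negPf (mpolyX_neq0 _)) => /eqP.
apply/ffunP => A; rewrite ffunE.
case: (#|A| =P (n - 2)%N) => [cA|/eqP cA]; last exact: w_deg.
have /cards2P[i [j [ij AE]]] : #|~: A| == 2.
  by rewrite cardsCs setCK card_ord cA subKn // ltnW.
have := coefE _ _ ij; rewrite !vertex0 !mulr0 subr0 => /esym/eqP.
rewrite mulf_eq0 (negPf (mpolyX_neq0 _)) => /eqP.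
move/(congr1 ( *%R (orientation i j))).
by rewrite /edge_coef -AE setCK mulrA orientationK mul1r mulr0.
Qed.

Lemma bourbaki_map_onto (c : 'I_n -> S) : exists2 w : W,
  forall A, #|A| != (n - 2)%N -> w A = 0 &
  bourbaki_map w = \sum_i c i *: cycle_generator K i.
Proof.
exists [ffun A : {set 'I_n} =>
  \sum_(i | A == ~: [set i; ordS i]) orientation i (ordS i) * c i : S].
  move=> A cA; rewrite ffunE big_pred0 // => i; apply: contraNF cA => /eqP ->.
  by rewrite cardsCs setCK card_ord cards2 [i == _]eq_sym ordS_neq.
apply: eq_bigr => i _; congr (_ * _); rewrite /edge_coef ffunE.
rewrite (big_pred1 i) => [|m]; first by rewrite mulrA orientationK mul1r.
by rewrite (inj_eq (@setC_inj _)) (inj_eq edge_inj) eq_sym.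
Qed.

(** * The Bourbaki sequence *)

Definition edge_complement A := [exists i, A == ~: [set i; ordS i]].

Definition to_image d (w : {ffun {A : {set 'I_n} | #|A| == d} -> S^o}) :
    koszul_image n K d :=
  exist _ (koszul_diff w : koszul n K d.-1) (asboolT (ex_intro _ w erefl)).

Fact to_image_linear d : linear (@to_image d).
Proof. by move=> a v w; apply: val_inj; rewrite linearP /= -linearP. Qed.

HB.instance Definition _ d :=
  GRing.isLinear.Build S _ _ _ (@to_image d) (@to_image_linear d).

Lemma to_image_onto d (z : koszul_image n K d) :
  exists w : {ffun {A : {set 'I_n} | #|A| == d} -> S^o}, to_image w = z.
Proof.
by case: z => z zP; have /asboolP[w wz] := zP; exists w; apply: val_inj.
Qed.

Lemma to_image_eq0 d (w : {ffun {A : {set 'I_n} | #|A| == d} -> S^o}) :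
  (0 < d)%N -> to_image w = 0 <-> diff (extend w) = 0.
Proof.
move=> d_gt0; rewrite -extend_koszul_diff //.
split=> [/(congr1 val) /= -> | dw0].
  by rewrite linear0.
by apply: val_inj; apply: extend_inj; rewrite dw0 linear0.
Qed.

End Cycle.
End Koszul.

Theorem proposition5p3 (n : nat) (hn : (3 <= n)%N) (K : fieldType) :
  bourbaki_ideal (koszul_image n K (n - 2)) (generated (@cycle_generator n K)).
Proof.
have d_gt0 : (0 < n - 2)%N by rewrite subn_gt0.
pose deg (A : {set 'I_n}) := #|A| == (n - 2)%N.
pose off_edge (A : {A | deg A}) := ~~ edge_complement (val A).
pose iota := @extend {mpoly K[n]} _ off_edge.
pose ext := @extend {mpoly K[n]} _ deg.
split; first exact: (fingen_of_surjective (@to_image_onto n K (n - 2))).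
exists {ffun {A | off_edge A} -> {mpoly K[n]}^o}.
have iota_edge v i : ext (iota v) (~: [set i; ordS i]) = 0.
  rewrite ffunE; case: insubP => [A _ valA|//]; apply: extend_out.
  by rewrite /off_edge negbK valA; apply/existsP; exists i.
have [|||||||f [g fg]] := @short_exact_of_cover _ _ _ _
  (generated (@cycle_generator n K)) (@to_image n K (n - 2))
  (bourbaki_map (K := K) (n := n) \o ext) iota.
- exact: to_image_onto.
- move=> w; apply/asboolP; exists (fun i => edge_coef (ext w) i (ordS i)).
  by [].
- move=> r /asboolP[c ->]; have [w w_deg <-] := bourbaki_map_onto hn c.
  by have [v <-] := extend_onto w_deg; exists v.
- by move=> w /(to_image_eq0 _ d_gt0); apply: bourbaki_map_cycle.
- move=> v /(to_image_eq0 _ d_gt0) dv0; apply: (@extend_inj _ _ off_edge).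
  apply: (@extend_inj _ _ deg); rewrite !linear0.
  apply: no_cycle_off_edges dv0 => // [A cA|i]; last exact: iota_edge.
  exact: extend_out.
- move=> v; rewrite /= /bourbaki_map big1 // => i _.
  by rewrite /edge_coef iota_edge mulr0 mul0r.
- move=> w /(bourbaki_map_ker hn)[u u_deg wu_edge].
  have [w' w'E] : exists w', ext w' = ext w - diff u.
    apply: extend_onto => A cA; rewrite !ffunE insubN //= add0r.
    rewrite big1 ?oppr0 // => i iA; rewrite u_deg ?mulr0 //.
    by move: cA; rewrite /deg cardsU1 iA; lia.
  have [v vE] : exists v, iota v = w'.
    apply: extend_onto => A; rewrite negbK => /existsP[i /eqP AE].
    by rewrite -(extend_val w') -/ext w'E AE wu_edge.
  have [_ dv0] := to_image_eq0 (w' - w) d_gt0.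
  exists v; apply/subr0_eq; rewrite -linearB [X in X - w]vE; apply: dv0.
  rewrite linearB [X in diff (X - _)]w'E addrAC subrr add0r.
  by rewrite linearN /= diffK oppr0.
by exists f, g; split=> //; apply: ffun_free.
Qed.
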